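(* Let $\mathcal{A}$ be an abelian category with enough projectives (for example, the category of left modules over a ring) and let $F:\mathcal{A}\to\mathbf{Ab}$ be an additive contravariant functor. Consider the right fundamental sequence of $F$, i.e. the sequence of functors and natural transformations $$0\to\overline{F}\to F\xrightarrow{\rho_F}R_0F\xrightarrow{\beta_F}\overline{F}\circ\Omega\to S^1F\to R_1F\to\overline{F}\circ\Omega^2\to S^2F\to R_2F\to\overline{F}\circ\Omega^3\to S^3F\to\cdots .$$ Then: (1) The right fundamental sequence is a complex whose homology is zero except, possibly, at the terms $R_iF$. (2) If $F$ is half-exact, then the sequence is exact. (3) If $F$ carries monomorphisms to epimorphisms, then $\beta_F$ is epic. (4) If $F$ carries epimorphisms to monomorphisms, then $\overline{F}=0$ and $\rho_F$ is monic. (5) $\rho_F$ is an isomorphism if and only if $F$ is left-exact.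
   Context: $\mathbf{Ab}$ is the category of abelian groups. A contravariant additive functor $F$ is half-exact if for each short exact sequence $0\to A\to B\to C\to0$ the sequence $F(C)\to F(B)\to F(A)$ is exact at $F(B)$; it is left-exact if it carries each exact sequence $A\to B\to C\to0$ to an exact sequence $0\to F(C)\to F(B)\to F(A)$. Construction of the right fundamental sequence of a contravariant functor. For an object $B$ choose a projective resolution $\cdots\to P_1\xrightarrow{d_1}P_0\to B\to0$. Put $\Omega^0B=B$, let $e_0:P_0\to B$ be the given epimorphism, and for $i\ge0$ let $m_i:\Omega^{i+1}B\to P_i$ be the kernel of $e_i:P_i\to\Omega^iB$ and $e_{i+1}:P_{i+1}\to\Omega^{i+1}B$ the epimorphism with $d_{i+1}=m_ie_{i+1}$. Define: - $R_iF(B)=\mathrm{Ker}(F(d_{i+1}):F(P_i)\to F(P_{i+1}))/\mathrm{Im}\,F(d_i)$ (with $\mathrm{Im}\,F(d_0):=0$), the right-derived functors; - the sub-stabilization $\overline{F}(B)=\mathrm{Ker}(F(e_0):F(B)\to F(P_0))$, which equals the kernel of the canonical map $\rho_F:F\to R_0F$ induced by $F(e_0)$; since $\overline{F}$ vanishes on projectives, $\overline{F}\circ\Omega^i$ is a well-defined functor, with $\overline{F}(\Omega^iB)=\mathrm{Ker}(F(e_i):F(\Omega^iB)\to F(P_i))$; - the right satellites $S^0F=F$ and, for $i\ge1$, $S^iF(B)=\mathrm{Coker}(F(m_{i-1}):F(P_{i-1})\to F(\Omega^iB))$. These are independent of the choice of resolution and functorial in $B$. The maps of the sequence, for $i\ge0$,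 are: $\overline{F}(\Omega^iB)\to S^iF(B)$ is the inclusion into $F(\Omega^iB)$ followed by the projection; $S^iF(B)\to R_iF(B)$ is induced by $F(e_i):F(\Omega^iB)\to\mathrm{Ker}\,F(d_{i+1})$ (for $i=0$ this is $\rho_F$); $R_iF(B)\to\overline{F}(\Omega^{i+1}B)$ is induced by $F(m_i):F(P_i)\to F(\Omega^{i+1}B)$ (for $i=0$ this is $\beta_F$). *)

(* Defs.v *)
From HB Require Import structures.
From mathcomp Require Import all_boot all_order all_algebra.
From mathcomp Require Import ring_quotient.
From mathcomp Require Import boolp.

Set Implicit Arguments.
Unset Strict Implicit.
Unset Printing Implicit Defensive.

Import GRing.Theory.
Local Open Scope ring_scope.
Local Open Scope quotient_scope.

(* Abelian groups are [zmodType]s: the equality test and the choice operator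
   they carry exist on every abelian group by classical logic and choice. *)

Section AbelianGroups.

Definition surj (U V : Type) (f : U -> V) : Prop := forall y, exists x, f x = y.

Definition ab_exact (U V W : zmodType) (f : U -> V) (g : V -> W) : Prop :=
  forall y, g y = 0 <-> exists x, f x = y.

Section Kernel.
Variables (U V : zmodType) (f : {additive U -> V}).

Definition ker_pred : {pred U} := fun x => f x == 0.

Lemma ker_zmod_closed : zmod_closed ker_pred.
Proof.
split=> [|x y]; rewrite /ker_pred !unfold_in ?raddf0 //.
by move=> /eqP fx /eqP fy; rewrite raddfB fx fy subrr.
Qed.

HB.instance Definition _ := GRing.isZmodClosed.Build U ker_pred ker_zmod_closed.

Record ab_ker := AbKer { ker_val : U; _ : ker_val \in ker_pred }.

HB.instance Definition _ := [isSub for ker_val].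
HB.instance Definition _ := [Choice of ab_ker by <:].
HB.instance Definition _ := [SubChoice_isSubZmodule of ab_ker by <:].

Lemma ker_valP (x : ab_ker) : f (val x) = 0.
Proof. by apply/eqP; exact: (valP x). Qed.

Lemma ker_valB (x y : ab_ker) : val (x - y) = val x - val y.
Proof. exact: raddfB. Qed.

Lemma ker_valD (x y : ab_ker) : val (x + y) = val x + val y.
Proof. exact: raddfD. Qed.

Lemma ker_val_zmod : zmod_morphism ker_val.
Proof. exact: (raddfB (val : ab_ker -> U)). Qed.

HB.instance Definition _ :=
  GRing.isZmodMorphism.Build ab_ker U ker_val ker_val_zmod.

Section KerLift.
Variables (W : zmodType) (g : {additive W -> U}) (fg0 : forall x, f (g x) = 0).

Lemma ker_lift_proof x : g x \in ker_pred. Proof. exact/eqP/fg0. Qed.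

Definition ker_lift_fun (x : W) : ab_ker := AbKer (ker_lift_proof x).

Lemma ker_lift_zmod : zmod_morphism ker_lift_fun.
Proof. by move=> x y; apply: val_inj; rewrite /= raddfB. Qed.

HB.instance Definition _ :=
  GRing.isZmodMorphism.Build W ab_ker ker_lift_fun ker_lift_zmod.

Definition ker_lift : {additive W -> ab_ker} := ker_lift_fun.

Lemma ker_liftE x : val (ker_lift x) = g x. Proof. by []. Qed.
End KerLift.

End Kernel.

Section KerMap.
Variables (U V U' V' : zmodType).
Variables (g : {additive U -> V}) (g' : {additive U' -> V'}).
Variables (a : {additive U -> U'}) (ga : forall x, g x = 0 -> g' (a x) = 0).

Lemma ker_map_proof (x : ab_ker g) : g' ((a \o @ker_val _ _ g) x) = 0.
Proof. by apply: ga; exact: ker_valP. Qed.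

Definition ker_map : {additive ab_ker g -> ab_ker g'} := ker_lift ker_map_proof.

Lemma ker_mapE x : val (ker_map x) = a (val x). Proof. by []. Qed.
End KerMap.

Section Image.
Variables (U V : zmodType) (f : {additive U -> V}).

Definition im_pred : {pred V} := fun y => `[< exists x, f x = y >].

Lemma im_predP y : reflect (exists x, f x = y) (y \in im_pred).
Proof. exact: asboolP. Qed.

Lemma im_zmod_closed : zmod_closed im_pred.
Proof.
split=> [|_ _ /im_predP[x <-] /im_predP[y <-]]; apply/im_predP.
  by exists 0; rewrite raddf0.
by exists (x - y); rewrite raddfB.
Qed.

HB.instance Definition _ := GRing.isZmodClosed.Build V im_pred im_zmod_closed.

End Image.

(* The quotient of V by a subgroup N is [Quotient.quot N]. *)
Section QuotMap.
Variables (V : zmodType) (N : zmodClosed V).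

Definition quot_proj : {additive V -> Quotient.quot N} := \pi_(Quotient.quot N).

Lemma quot_projP x y : reflect (quot_proj x = quot_proj y) (x - y \in N).
Proof. by rewrite Quotient.idealrBE; apply: eqP. Qed.

Lemma quot_proj_surj (y : Quotient.quot N) : exists x, quot_proj x = y.
Proof. by exists (repr y); rewrite /quot_proj /= reprK. Qed.

Section Desc.
Variables (W : zmodType) (f : {additive V -> W}).
Hypothesis fN : forall x, x \in N -> f x = 0.

Definition quot_desc_fun (y : Quotient.quot N) : W := f (repr y).

Lemma quot_desc_funE x : quot_desc_fun (quot_proj x) = f x.
Proof.
apply/eqP; rewrite -subr_eq0 -raddfB; apply/eqP/fN/quot_projP.
by rewrite /quot_proj /= reprK.
Qed.

Lemma quot_desc_zmod : zmod_morphism quot_desc_fun.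
Proof.
move=> x y; have [x' <-] := quot_proj_surj x; have [y' <-] := quot_proj_surj y.
by rewrite -raddfB !quot_desc_funE raddfB.
Qed.

HB.instance Definition _ :=
  GRing.isZmodMorphism.Build (Quotient.quot N) W quot_desc_fun quot_desc_zmod.

Definition quot_desc : {additive Quotient.quot N -> W} := quot_desc_fun.

Lemma quot_descE x : quot_desc (quot_proj x) = f x.
Proof. exact: quot_desc_funE. Qed.
End Desc.

End QuotMap.

Section QuotMap2.
Variables (U V : zmodType) (M : zmodClosed U) (N : zmodClosed V).
Variables (f : {additive U -> V}) (fMN : forall x, x \in M -> f x \in N).

Lemma quot_map_proof x : x \in M -> (quot_proj N \o f) x = 0.
Proof.
by move=> /fMN fx; rewrite -(raddf0 (quot_proj N)); apply/quot_projP; rewrite subr0.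
Qed.

Definition quot_map : {additive Quotient.quot M -> Quotient.quot N} :=
  quot_desc quot_map_proof.

Lemma quot_mapE x : quot_map (quot_proj M x) = quot_proj N (f x).
Proof. exact: quot_descE. Qed.
End QuotMap2.

End AbelianGroups.

Record preadditive := Preadditive {
  obj :> Type;
  hom : obj -> obj -> zmodType;
  idm : forall X, hom X X;
  cmp : forall X Y Z, hom Y Z -> hom X Y -> hom X Z;
  cmp1m : forall X Y (f : hom X Y), cmp (idm Y) f = f;
  cmpm1 : forall X Y (f : hom X Y), cmp f (idm X) = f;
  cmpA : forall X Y Z T (h : hom Z T) (g : hom Y Z) (f : hom X Y),
    cmp h (cmp g f) = cmp (cmp h g) f;
  cmpDl : forall X Y Z (g g' : hom Y Z) (f : hom X Y),
    cmp (g + g') f = cmp g f + cmp g' f;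
  cmpDr : forall X Y Z (g : hom Y Z) (f f' : hom X Y),
    cmp g (f + f') = cmp g f + cmp g f'
}.

Arguments idm {p} X.
Notation "g \oc f" := (cmp g f) (at level 40, left associativity).

Section AbelianCategories.
Variable A : preadditive.
Implicit Types X Y Z : A.

Lemma cmp0m X Y Z (f : hom X Y) : (0 : hom Y Z) \oc f = 0.
Proof. by apply: (addIr (0 \oc f)); rewrite -cmpDl !add0r. Qed.

Lemma cmpm0 X Y Z (g : hom Y Z) : g \oc (0 : hom X Y) = 0.
Proof. by apply: (addIr (g \oc 0)); rewrite -cmpDr !add0r. Qed.

Lemma cmpNl X Y Z (g : hom Y Z) (f : hom X Y) : (- g) \oc f = - (g \oc f).
Proof. by apply/eqP; rewrite -addr_eq0 -cmpDl addNr cmp0m. Qed.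

Lemma cmpNr X Y Z (g : hom Y Z) (f : hom X Y) : g \oc (- f) = - (g \oc f).
Proof. by apply/eqP; rewrite -addr_eq0 -cmpDr addNr cmpm0. Qed.

Definition mono X Y (f : hom X Y) : Prop :=
  forall Z (g h : hom Z X), f \oc g = f \oc h -> g = h.

Definition epi X Y (f : hom X Y) : Prop :=
  forall Z (g h : hom Y Z), g \oc f = h \oc f -> g = h.

Definition is_kernel K X Y (k : hom K X) (f : hom X Y) : Prop :=
  f \oc k = 0 /\
  forall Z (g : hom Z X), f \oc g = 0 -> exists! h : hom Z K, k \oc h = g.

Definition is_cokernel X Y C (c : hom Y C) (f : hom X Y) : Prop :=
  c \oc f = 0 /\
  forall Z (g : hom Y Z), g \oc f = 0 -> exists! h : hom C Z, h \oc c = g.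

Definition is_zero Z : Prop :=
  (forall X (f : hom X Z), f = 0) /\ (forall X (f : hom Z X), f = 0).

Definition is_biproduct X Y S (p : hom S X) (q : hom S Y)
    (i : hom X S) (j : hom Y S) : Prop :=
  [/\ p \oc i = idm X, q \oc j = idm Y, p \oc j = 0, q \oc i = 0
    & i \oc p + j \oc q = idm S].

Record abelian : Prop := Abelian {
  ab_zero : exists Z, is_zero Z;
  ab_biproduct : forall X Y, exists S (p : hom S X) (q : hom S Y)
    (i : hom X S) (j : hom Y S), is_biproduct p q i j;
  ab_kernel : forall X Y (f : hom X Y), exists K (k : hom K X), is_kernel k f;
  ab_cokernel : forall X Y (f : hom X Y),
    exists C (c : hom Y C), is_cokernel c f;
  ab_mono_normal : forall X Y (f : hom X Y), mono f ->
    exists Z (g : hom Y Z), is_kernel f g;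
  ab_epi_normal : forall X Y (f : hom X Y), epi f ->
    exists Z (g : hom Z X), is_cokernel f g
}.

(* exactness of X -f-> Y -g-> Z at Y: the image of f, i.e. the monomorphism of
   an epi-mono factorisation of f, is a kernel of g *)
Definition exact_at X Y Z (f : hom X Y) (g : hom Y Z) : Prop :=
  exists I (e : hom X I) (k : hom I Y), [/\ f = k \oc e, epi e & is_kernel k g].

Definition short_exact X Y Z (f : hom X Y) (g : hom Y Z) : Prop :=
  [/\ mono f, exact_at f g & epi g].

Definition right_exact X Y Z (f : hom X Y) (g : hom Y Z) : Prop :=
  exact_at f g /\ epi g.

Definition projective P : Prop :=
  forall X Y (e : hom X Y) (f : hom P Y), epi e -> exists g : hom P X, e \oc g = f.

Definition enough_projectives : Prop :=
  forall X, exists P (e : hom P X), projective P /\ epi e.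

Lemma kernel_mono K X Y (k : hom K X) (f : hom X Y) : is_kernel k f -> mono k.
Proof.
move=> [fk0 kP] Z g h kgh.
have [|l [_ lU]] := kP Z (k \oc g); first by rewrite cmpA fk0 cmp0m.
by rewrite -(lU g) // -(lU h).
Qed.

Lemma kernel_fact K X Y (k : hom K X) (f : hom X Y) Z (g : hom Z X) :
  is_kernel k f -> f \oc g = 0 -> exists h : hom Z K, k \oc h = g.
Proof. by move=> [_ kP] /kP [h [kh _]]; exists h. Qed.

End AbelianCategories.

Section Syzygies.
Variables (A : preadditive) (B : A).

Definition syzygy_of (Om : nat -> A) (i : nat) : A :=
  if i is j.+1 then Om j else B.

(* A projective resolution ... -> P_1 -> P_0 -> B -> 0 given together with the
   factorisation of its differentials through the syzygies: [rsyz i] is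
   Omega^i B, [rm i] a kernel of [re i], and the differential
   d_(i+1) : P_(i+1) -> P_i is [rd i] below. *)
Record resolution := Resolution {
  rproj : nat -> A;
  rsyzS : nat -> A;
  re : forall i, hom (rproj i) (syzygy_of rsyzS i);
  rm : forall i, hom (rsyzS i) (rproj i);
  rproj_projective : forall i, projective (rproj i);
  re_epi : forall i, epi (re i);
  rm_kernel : forall i, is_kernel (rm i) (re i)
}.

Definition rsyz (P : resolution) (i : nat) : A := syzygy_of (rsyzS P) i.

Definition rd (P : resolution) (i : nat) : hom (rproj P i.+1) (rproj P i) :=
  rm P i \oc re P i.+1.

Lemma re_rm P i : re P i \oc rm P i = 0.
Proof. by case: (rm_kernel P i). Qed.

Lemma rd_rm P i : rd P i \oc rm P i.+1 = 0.
Proof. by rewrite /rd -cmpA re_rm cmpm0. Qed.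

Lemma rd_rd P i : rd P i \oc rd P i.+1 = 0.
Proof. by rewrite {2}/rd cmpA rd_rm cmp0m. Qed.

Lemma rd_exact0 P : exact_at (rd P 0) (re P 0).
Proof.
by exists (rsyz P 1), (re P 1), (rm P 0); split=> //; [apply: re_epi|apply: rm_kernel].
Qed.

Lemma rd_exactS P i : exact_at (rd P i.+1) (rd P i).
Proof.
exists (rsyz P i.+2), (re P i.+2), (rm P i.+1); split=> //; first exact: re_epi.
have mm := kernel_mono (rm_kernel P i); split; first exact: rd_rm.
move=> Z g; rewrite /rd -cmpA => dg0; apply: (rm_kernel P i.+1).2.
by apply: mm; rewrite dg0 cmpm0.
Qed.

End Syzygies.

Arguments re_epi {A B} r i : rename.

Lemma resolution_exists (A : preadditive) :
  abelian A -> enough_projectives A -> inhabited (forall B : A, resolution B).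
Proof.
move=> abA enA.
suff H (B : A) : exists r : resolution B, True.
  by constructor=> B; exact: sval (cid (H B)).
have step (X : A) : exists t : {P : A & {K : A & (hom P X * hom K P)%type}},
    let: existT P (existT K em) := t in
    [/\ projective P, epi em.1 & is_kernel em.2 em.1].
  have [P [e [Pp ee]]] := enA X; have [K [k kk]] := ab_kernel abA e.
  by exists (existT _ P (existT _ K (e, k))).
pose s X := sval (cid (step X)); pose P X : A := projT1 (s X).
pose K X : A := projT1 (projT2 (s X)).
pose e X : hom (P X) X := (projT2 (projT2 (s X))).1.
pose m X : hom (K X) (P X) := (projT2 (projT2 (s X))).2.
have sP X : [/\ projective (P X), epi (e X) & is_kernel (m X) (e X)].
  rewrite /e /m /K /P /s; case: (cid _) => -[Q [L em]] /= H; exact: H.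
pose Om i := iter i.+1 K B.
pose Pr i := P (syzygy_of B Om i).
have Q i : {em : hom (Pr i) (syzygy_of B Om i) * hom (Om i) (Pr i) |
    [/\ projective (Pr i), epi em.1 & is_kernel em.2 em.1]}.
  by case: i => [|i]; [exists (e B, m B)|exists (e (Om i), m (Om i))]; apply: sP.
unshelve eexists; [exists Pr Om (fun i => (sval (Q i)).1) (fun i => (sval (Q i)).2) | by []].
all: by move=> i; case: (Q i) => -[? ?] [].
Qed.

Section Lifting.
Variables (A : preadditive) (B B' : A) (P : resolution B) (P' : resolution B').

Definition lift_step_spec i (w : hom (rsyz P i) (rsyz P' i))
    (pw : hom (rproj P i) (rproj P' i) * hom (rsyz P i.+1) (rsyz P' i.+1)) :=
  re P' i \oc pw.1 = w \oc re P i /\ rm P' i \oc pw.2 = pw.1 \oc rm P i.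

Lemma lift_step_ex i w : exists pw, @lift_step_spec i w pw.
Proof.
have [p pE] := @rproj_projective _ _ P i _ _ (re P' i) (w \oc re P i) (re_epi P' i).
have [|w' wE] := @kernel_fact A _ _ _ _ _ _ (p \oc rm P i) (rm_kernel P' i).
  by rewrite cmpA pE -cmpA re_rm cmpm0.
by exists (p, w').
Qed.

Definition lift_step i w := sval (cid (@lift_step_ex i w)).

Variable f : hom B B'.

(* Omega^i f and P_i -> P'_i, for a chosen lift of f to the resolutions *)
Fixpoint lift_syz i : hom (rsyz P i) (rsyz P' i) :=
  if i is j.+1 return hom (rsyz P i) (rsyz P' i)
  then (lift_step (lift_syz j)).2 else f.

Definition lift_proj i : hom (rproj P i) (rproj P' i) :=
  (lift_step (lift_syz i)).1.

Definition is_lift (w : forall i, hom (rsyz P i) (rsyz P' i))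
    (p : forall i, hom (rproj P i) (rproj P' i)) : Prop :=
  [/\ w 0 = f, forall i, re P' i \oc p i = w i \oc re P i
    & forall i, rm P' i \oc w i.+1 = p i \oc rm P i].

Lemma lift_is_lift : is_lift lift_syz lift_proj.
Proof.
by split=> // i; have [] := svalP (cid (lift_step_ex (lift_syz i))).
Qed.

Section Unique.
Variables (w w' : forall i, hom (rsyz P i) (rsyz P' i)).
Variables (p p' : forall i, hom (rproj P i) (rproj P' i)).
Hypotheses (wpP : is_lift w p) (wpP' : is_lift w' p').

Lemma lift_diff_step i (u : hom (rproj P i) (rproj P' i)) :
    (w i - w' i) \oc re P i = re P' i \oc u -> u \oc rm P i = 0 ->
  exists s : hom (rproj P i) (rproj P' i.+1),
    p i - p' i = u + rd P' i \oc s /\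
    w i.+1 - w' i.+1 = re P' i.+1 \oc s \oc rm P i.
Proof.
have [_ eE mE] := wpP; have [_ eE' mE'] := wpP'; move=> wu um0.
have [|h hE] := @kernel_fact A _ _ _ _ _ _ (p i - p' i - u) (rm_kernel P' i).
  by rewrite !cmpDr !cmpNr eE eE' -[- (w' i \oc _)]cmpNl -cmpDl wu subrr.
have [s sE] := @rproj_projective _ _ P i _ _ (re P' i.+1) h (re_epi P' i.+1).
exists s; split; first by rewrite /rd -cmpA sE hE [RHS]addrC subrK.
apply: (kernel_mono (rm_kernel P' i)).
by rewrite cmpDr cmpNr mE mE' -cmpNl -cmpDl sE cmpA hE [in RHS]cmpDl cmpNl um0 subr0.
Qed.

Lemma lift_diff0 : w 0 = w' 0 /\ exists s : hom (rproj P 0) (rproj P' 1),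
  p 0 - p' 0 = rd P' 0 \oc s /\ w 1 - w' 1 = re P' 1 \oc s \oc rm P 0.
Proof.
have [w0 _ _] := wpP; have [w0' _ _] := wpP'; split; first by rewrite w0 w0'.
have [||s [pE wE]] := @lift_diff_step 0 0.
- by rewrite w0 w0' subrr cmp0m cmpm0.
- by rewrite cmp0m.
by exists s; split=> //; rewrite pE add0r.
Qed.

Lemma lift_diff_syz i : exists s : hom (rproj P i) (rproj P' i.+1),
  w i.+1 - w' i.+1 = re P' i.+1 \oc s \oc rm P i.
Proof.
elim: i => [|i [s sE]]; first by have [_ [s [_ sE]]] := lift_diff0; exists s.
have [||t [_ tE]] := @lift_diff_step i.+1 (s \oc rd P i); last by exists t.
  by rewrite sE -!cmpA.
by rewrite -cmpA rd_rm cmpm0.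
Qed.

Lemma lift_diff_proj i : exists (s : hom (rproj P i) (rproj P' i.+1))
    (t : hom (rproj P i.+1) (rproj P' i.+2)),
  p i.+1 - p' i.+1 = s \oc rd P i + rd P' i.+1 \oc t.
Proof.
have [s sE] := lift_diff_syz i.
have [||t [tE _]] := @lift_diff_step i.+1 (s \oc rd P i); last by exists s, t.
  by rewrite sE -!cmpA.
by rewrite -cmpA rd_rm cmpm0.
Qed.

End Unique.

End Lifting.

Section LiftOps.
Variable A : preadditive.

Lemma is_lift1 (B : A) (P : resolution B) :
  is_lift (P := P) (P' := P) (idm B) (fun i => idm _) (fun i => idm _).
Proof. by split=> // i; rewrite cmp1m cmpm1. Qed.

Lemma is_liftC (B B' B'' : A) (P : resolution B) (P' : resolution B')
    (P'' : resolution B'') (g : hom B' B'') (f : hom B B') w p w' p' :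
  is_lift (P := P') (P' := P'') g w' p' -> is_lift (P := P) (P' := P') f w p ->
  is_lift (P := P) (P' := P'') (g \oc f)
    (fun i => w' i \oc w i) (fun i => p' i \oc p i).
Proof.
move=> [w0' e' m'] [w0 e m]; split=> [|i|i]; first by rewrite w0 w0'.
  by rewrite cmpA e' -!cmpA e.
by rewrite cmpA m' -!cmpA m.
Qed.

Lemma is_liftD (B B' : A) (P : resolution B) (P' : resolution B')
    (f g : hom B B') w p w' p' :
  is_lift (P := P) (P' := P') f w p -> is_lift (P := P) (P' := P') g w' p' ->
  is_lift (P := P) (P' := P') (f + g)
    (fun i => w i + w' i) (fun i => p i + p' i).
Proof.
move=> [w0 e m] [w0' e' m']; split=> [|i|i]; first by rewrite w0 w0'.
  by rewrite cmpDr cmpDl e e'.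
by rewrite cmpDr cmpDl m m'.
Qed.

Lemma lift_rd (B B' : A) (P : resolution B) (P' : resolution B') f w p :
  is_lift (P := P) (P' := P') f w p ->
  forall i, rd P' i \oc p i.+1 = p i \oc rd P i.
Proof. by move=> [_ e m] i; rewrite /rd -cmpA e !cmpA m. Qed.

End LiftOps.

Section Functors.
Variable A : preadditive.

(* additive contravariant functors from A to abelian groups *)
Record cfunctor := CFunctor {
  fobj :> A -> zmodType;
  fmap : forall X Y : A, hom X Y -> {additive fobj Y -> fobj X};
  fmap1 : forall X x, fmap (idm X) x = x;
  fmapC : forall X Y Z (g : hom Y Z) (f : hom X Y) x,
    fmap (g \oc f) x = fmap f (fmap g x);
  fmapD : forall X Y (f g : hom X Y) x, fmap (f + g) x = fmap f x + fmap g x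
}.

Record nattrans (F G : cfunctor) := NatTrans {
  ntapp :> forall X, {additive F X -> G X};
  ntnat : forall X Y (f : hom X Y) y, ntapp X (fmap F f y) = fmap G f (ntapp Y y)
}.

Implicit Types F G H : cfunctor.

(* Kernels, images and exactness of functors with values in abelian groups are
   computed objectwise. *)
Definition nt_exact F G H (a : nattrans F G) (b : nattrans G H) : Prop :=
  forall X, ab_exact (a X) (b X).

Definition nt_comp_zero F G H (a : nattrans F G) (b : nattrans G H) : Prop :=
  forall X x, b X (a X x) = 0.

Definition nt_monic F G (a : nattrans F G) : Prop := forall X, injective (a X).

Definition nt_epic F G (a : nattrans F G) : Prop := forall X, surj (a X).

Definition nt_iso F G (a : nattrans F G) : Prop :=
  exists b : nattrans G F, forall X, cancel (a X) (b X) /\ cancel (b X) (a X).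

Definition zero_functor F : Prop := forall X (x : F X), x = 0.

Definition half_exact F : Prop :=
  forall X Y Z (f : hom X Y) (g : hom Y Z),
    short_exact f g -> ab_exact (fmap F g) (fmap F f).

Definition left_exact F : Prop :=
  forall X Y Z (f : hom X Y) (g : hom Y Z), right_exact f g ->
    injective (fmap F g) /\ ab_exact (fmap F g) (fmap F f).

Definition mono_to_epi F : Prop :=
  forall X Y (f : hom X Y), mono f -> surj (fmap F f).

Definition epi_to_mono F : Prop :=
  forall X Y (f : hom X Y), epi f -> injective (fmap F f).

Lemma fmap0 F X Y x : fmap F (0 : hom X Y) x = 0.
Proof. by apply: (addIr (fmap F 0 x)); rewrite -fmapD !add0r. Qed.

Lemma fmapN F X Y (f : hom X Y) x : fmap F (- f) x = - fmap F f x.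
Proof. by apply/eqP; rewrite -addr_eq0 -fmapD addNr fmap0. Qed.

Lemma fmapB F X Y (f g : hom X Y) x : fmap F (f - g) x = fmap F f x - fmap F g x.
Proof. by rewrite fmapD fmapN. Qed.

Section QuotFunctor.
Variables (U : A -> zmodType) (N : forall X, zmodClosed (U X)).
Variable u : forall X Y, hom X Y -> {additive U Y -> U X}.
Hypothesis uN : forall X Y (f : hom X Y) y, y \in N Y -> u f y \in N X.
Hypothesis u1 : forall X x, u (idm X) x - x \in N X.
Hypothesis uC : forall X Y Z (g : hom Y Z) (f : hom X Y) x,
  u (g \oc f) x - u f (u g x) \in N X.
Hypothesis uD : forall X Y (f g : hom X Y) x,
  u (f + g) x - (u f x + u g x) \in N X.

Definition quot_functor : cfunctor.
Proof.
refine (@CFunctor (fun X => Quotient.quot (N X))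
  (fun X Y f => quot_map (@uN X Y f)) _ _ _).
- abstract (by move=> X x; have [y <-] := quot_proj_surj x;
    rewrite quot_mapE; apply/quot_projP; exact: u1).
- abstract (by move=> X Y Z g f x; have [y <-] := quot_proj_surj x;
    rewrite !(quot_mapE _ y) quot_mapE; apply/quot_projP; exact: uC).
- abstract (by move=> X Y f g x; have [y <-] := quot_proj_surj x;
    rewrite !(quot_mapE _ y) -raddfD; apply/quot_projP; exact: uD).
Defined.
End QuotFunctor.

End Functors.

Section FundamentalSequence.
Variables (A : preadditive) (P : forall B : A, resolution B) (F : cfunctor A).

Notation lsyz f i := (lift_syz (P _) (P _) f i).
Notation lproj f i := (lift_proj (P _) (P _) f i).

Definition Fre (B : A) i : {additive F (rsyz (P B) i) -> F (rproj (P B) i)} :=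
  fmap F (re (P B) i).
Definition Frm (B : A) i : {additive F (rproj (P B) i) -> F (rsyz (P B) i.+1)} :=
  fmap F (rm (P B) i).
Definition Frd (B : A) i : {additive F (rproj (P B) i) -> F (rproj (P B) i.+1)} :=
  fmap F (rd (P B) i).

Lemma Frd_E B i x : Frd B i x = Fre B i.+1 (Frm B i x).
Proof. by rewrite /Frd /rd fmapC. Qed.

Lemma Frm_Fre B i x : Frm B i (Fre B i x) = 0.
Proof. by rewrite /Frm /Fre -fmapC re_rm fmap0. Qed.

Lemma Fre_lift B B' (f : hom B B') i x :
  Fre B i (fmap F (lsyz f i) x) = fmap F (lproj f i) (Fre B' i x).
Proof.
by rewrite /Fre -!fmapC; have [_ -> _] := lift_is_lift (P B) (P B') f.
Qed.

Lemma Frm_lift B B' (f : hom B B') i x :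
  Frm B i (fmap F (lproj f i) x) = fmap F (lsyz f i.+1) (Frm B' i x).
Proof.
by rewrite /Frm -!fmapC; have [_ _ ->] := lift_is_lift (P B) (P B') f.
Qed.

Lemma Frd_lift B B' (f : hom B B') i x :
  Frd B i (fmap F (lproj f i) x) = fmap F (lproj f i.+1) (Frd B' i x).
Proof. by rewrite !Frd_E Frm_lift Fre_lift. Qed.

Lemma lift_diff_ker B B' (f : hom B B') w p w' p' i x :
  is_lift (P := P B) (P' := P B') f w p ->
  is_lift (P := P B) (P' := P B') f w' p' ->
  Fre B' i x = 0 -> fmap F (w i) x = fmap F (w' i) x.
Proof.
move=> H H'; case: i x => [|i] x ex; first by have [-> _] := lift_diff0 H H'.
have [s sE] := lift_diff_syz H H' i; apply/eqP.
by rewrite -subr_eq0 -fmapB sE !fmapC -/(Fre B' i.+1) ex !raddf0.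
Qed.

Lemma lift_diff_im B B' (f : hom B B') w p w' p' i x :
  is_lift (P := P B) (P' := P B') f w p ->
  is_lift (P := P B) (P' := P B') f w' p' ->
  fmap F (w i.+1) x - fmap F (w' i.+1) x \in im_pred (Frm B i).
Proof.
move=> H H'; have [s sE] := lift_diff_syz H H' i; apply/im_predP.
by exists (fmap F (re (P B') i.+1 \oc s) x); rewrite -fmapB sE [in RHS]fmapC.
Qed.

Definition sub_stab_map i B B' (f : hom B B') :
  {additive ab_ker (Fre B' i) -> ab_ker (Fre B i)}.
Proof.
refine (@ker_map _ _ _ _ _ _ (fmap F (lsyz f i)) _).
abstract (by move=> x ex; rewrite Fre_lift ex raddf0).
Defined.

(* the sub-stabilization of F composed with Omega^i; the sub-stabilization
   itself is the case i = 0, since Omega^0 is the identity *)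
Definition sub_stab (i : nat) : cfunctor A.
Proof.
refine (@CFunctor A (fun B => ab_ker (Fre B i)) (sub_stab_map i) _ _ _).
- abstract (move=> X x; apply: val_inj; rewrite ker_mapE;
    rewrite (lift_diff_ker (lift_is_lift _ _ _) (is_lift1 _) (ker_valP x));
    exact: fmap1).
- abstract (move=> X Y Z g f x; apply: val_inj; rewrite !ker_mapE -fmapC;
    exact: (lift_diff_ker (lift_is_lift _ _ _)
      (is_liftC (lift_is_lift (P Y) (P Z) g) (lift_is_lift (P X) (P Y) f)) (ker_valP x))).
- abstract (move=> X Y f g x; apply: val_inj; rewrite raddfD !ker_mapE -fmapD;
    exact: (lift_diff_ker (lift_is_lift _ _ _)
      (is_liftD (lift_is_lift (P X) (P Y) f) (lift_is_lift (P X) (P Y) g)) (ker_valP x))).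
Defined.

(* Im F(d_i) inside F(P_i), with Im F(d_0) = 0 *)
Definition bound_pred (B : A) (i : nat) : {pred F (rproj (P B) i)} :=
  match i with 0 => pred1 0 | j.+1 => im_pred (Frd B j) end.
Arguments bound_pred : clear implicits.

Lemma bound_pred0 B y : (y \in bound_pred B 0) = (y == 0).
Proof. by []. Qed.

Lemma bound_predS B i y : (y \in bound_pred B i.+1) = (y \in im_pred (Frd B i)).
Proof. by []. Qed.

Lemma bound_zmod_closed B i : zmod_closed (bound_pred B i).
Proof.
case: i => [|i]; last exact: im_zmod_closed.
split=> [|x y]; rewrite !bound_pred0 // => /eqP -> /eqP ->.
by rewrite subr0.
Qed.

Definition cycle_bound_pred (B : A) (i : nat) : {pred ab_ker (Frd B i)} :=
  fun x => val x \in bound_pred B i.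
Arguments cycle_bound_pred : clear implicits.

Lemma cycle_boundE B i x :
  (x \in cycle_bound_pred B i) = (val x \in bound_pred B i).
Proof. by []. Qed.

Lemma cycle_bound_zmod_closed B i : zmod_closed (cycle_bound_pred B i).
Proof.
have [b0 bB] := bound_zmod_closed B i; split=> [|x y xb yb].
  by rewrite cycle_boundE raddf0.
by rewrite cycle_boundE ker_valB bB.
Qed.

HB.instance Definition _ B i :=
  GRing.isZmodClosed.Build _ (cycle_bound_pred B i) (cycle_bound_zmod_closed B i).

Lemma lift_diff_bound B B' (f : hom B B') w p w' p' i x :
  is_lift (P := P B) (P' := P B') f w p ->
  is_lift (P := P B) (P' := P B') f w' p' ->
  Frd B' i x = 0 -> fmap F (p i) x - fmap F (p' i) x \in bound_pred B i.
Proof.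
move=> H H'; rewrite -fmapB; case: i x => [|i] x dx.
  have [_ [s [-> _]]] := lift_diff0 H H'.
  by rewrite bound_pred0 fmapC -/(Frd B' 0) dx raddf0.
have [s [t ->]] := lift_diff_proj H H' i; apply/im_predP; exists (fmap F s x).
by rewrite fmapD [in RHS]fmapC [in X in _ + X]fmapC -/(Frd B' i.+1) dx raddf0 addr0.
Qed.

Definition cycle_map i B B' (f : hom B B') :
  {additive ab_ker (Frd B' i) -> ab_ker (Frd B i)}.
Proof.
refine (@ker_map _ _ _ _ _ _ (fmap F (lproj f i)) _).
abstract (by move=> x ex; rewrite Frd_lift ex raddf0).
Defined.

Lemma cycle_mapE i B B' (f : hom B B') x :
  val (cycle_map i f x) = fmap F (lproj f i) (val x).
Proof. by []. Qed.

Definition right_derived (i : nat) : cfunctor A.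
Proof.
refine (@quot_functor A (fun B => ab_ker (Frd B i))
  (fun B => cycle_bound_pred B i) (cycle_map i) _ _ _ _).
- abstract (move=> X Y f y; rewrite !cycle_boundE cycle_mapE;
    case: i y => [|j] y;
    first (by rewrite !bound_pred0 => /eqP ->; rewrite raddf0);
    by rewrite !bound_predS => /im_predP[z <-]; apply/im_predP; exists (fmap F (lproj f j) z);
    rewrite Frd_lift).
- abstract (move=> X x; rewrite cycle_boundE ker_valB cycle_mapE;
    rewrite -[X in _ - X]fmap1;
    apply: (lift_diff_bound (lift_is_lift _ _ _) (is_lift1 _) (ker_valP x))).
- abstract (move=> X Y Z g f x; rewrite cycle_boundE ker_valB;
    rewrite !cycle_mapE -fmapC;
    exact: (lift_diff_bound (lift_is_lift _ _ _)
      (is_liftC (lift_is_lift (P Y) (P Z) g) (lift_is_lift (P X) (P Y) f)) (ker_valP x))).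
- abstract (move=> X Y f g x; rewrite cycle_boundE ker_valB ker_valD;
    rewrite !cycle_mapE -fmapD;
    exact: (lift_diff_bound (lift_is_lift _ _ _)
      (is_liftD (lift_is_lift (P X) (P Y) f) (lift_is_lift (P X) (P Y) g)) (ker_valP x))).
Defined.

(* the right satellite S^(i+1) F *)
Definition satelliteS (i : nat) : cfunctor A.
Proof.
refine (@quot_functor A (fun B => F (rsyz (P B) i.+1))
  (fun B => im_pred (Frm B i)) (fun X Y f => fmap F (lsyz f i.+1)) _ _ _ _).
- abstract (by move=> X Y f _ /im_predP[z <-]; apply/im_predP;
    exists (fmap F (lproj f i) z); rewrite Frm_lift).
- abstract (by move=> X x; rewrite -[X in _ - X]fmap1;
    exact: (lift_diff_im x (lift_is_lift (P X) (P X) _) (is_lift1 (P X)))).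
- abstract (by move=> X Y Z g f x; rewrite -fmapC;
    exact: (lift_diff_im x (lift_is_lift _ _ _)
      (is_liftC (lift_is_lift (P Y) (P Z) g) (lift_is_lift (P X) (P Y) f)))).
- abstract (by move=> X Y f g x; rewrite -fmapD;
    exact: (lift_diff_im x (lift_is_lift _ _ _)
      (is_liftD (lift_is_lift (P X) (P Y) f) (lift_is_lift (P X) (P Y) g)))).
Defined.

Definition satellite (i : nat) : cfunctor A :=
  match i with 0 => F | j.+1 => satelliteS j end.

Definition sat_proj (B : A) (i : nat) : {additive F (rsyz (P B) i) -> satellite i B} :=
  match i with
  | 0 => (idfun : {additive F B -> F B})
  | j.+1 => quot_proj (im_pred (Frm B j))
  end.

Lemma sat_proj_surj B i : surj (sat_proj B i).
Proof. by case: i => [|i] y; [exists y|apply: quot_proj_surj]. Qed.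

Lemma sat_proj_nat B B' (f : hom B B') i x :
  sat_proj B i (fmap F (lsyz f i) x) = fmap (satellite i) f (sat_proj B' i x).
Proof. by case: i x => [//|i] x; rewrite [RHS]quot_mapE. Qed.

Definition der_proj (B : A) (i : nat) :
  {additive ab_ker (Frd B i) -> right_derived i B} :=
  quot_proj (cycle_bound_pred B i).

Lemma der_proj_surj B i : surj (der_proj B i).
Proof. by move=> y; apply: quot_proj_surj. Qed.

Lemma der_proj_nat B B' (f : hom B B') i x :
  der_proj B i (cycle_map i f x) = fmap (right_derived i) f (der_proj B' i x).
Proof. by rewrite [RHS]quot_mapE. Qed.

Definition stab_to_sat (i : nat) : nattrans (sub_stab i) (satellite i).
Proof.
refine (@NatTrans A (sub_stab i) (satellite i)
  (fun B => sat_proj B i \o @ker_val _ _ (Fre B i)) _).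
abstract (by move=> X Y f y; rewrite -sat_proj_nat).
Defined.

(* F(e_i) corestricted to Ker F(d_(i+1)) *)
Definition Fre_cycle (B : A) i : {additive F (rsyz (P B) i) -> ab_ker (Frd B i)}.
Proof.
refine (@ker_lift _ _ (Frd B i) _ (Fre B i) _).
abstract (by move=> x; rewrite Frd_E Frm_Fre raddf0).
Defined.

Lemma Fre_cycleE B i x : val (Fre_cycle B i x) = Fre B i x.
Proof. by []. Qed.

Lemma Fre_cycle_bound B j x :
  x \in im_pred (Frm B j) -> (der_proj B j.+1 \o Fre_cycle B j.+1) x = 0.
Proof.
move=> xm; rewrite -(raddf0 (der_proj B j.+1)); apply/quot_projP.
rewrite subr0 cycle_boundE Fre_cycleE.
by have /im_predP[y <-] := xm; apply/im_predP; exists y; rewrite Frd_E.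
Qed.

Definition sat_to_der_app (i : nat) (B : A) :
    {additive satellite i B -> right_derived i B} :=
  match i with
  | 0 => der_proj B 0 \o Fre_cycle B 0
  | j.+1 => quot_desc (@Fre_cycle_bound B j)
  end.

Lemma sat_to_der_appE i B x :
  sat_to_der_app i B (sat_proj B i x) = der_proj B i (Fre_cycle B i x).
Proof. by case: i x => [//|i] x; rewrite [LHS]quot_descE. Qed.

Definition sat_to_der (i : nat) : nattrans (satellite i) (right_derived i).
Proof.
refine (@NatTrans A (satellite i) (right_derived i) (sat_to_der_app i) _).
abstract (move=> X Y f y; have [x <-] := sat_proj_surj y;
  rewrite -sat_proj_nat !sat_to_der_appE -der_proj_nat; congr (der_proj _ _ _);
  apply: val_inj; rewrite cycle_mapE !Fre_cycleE; exact: Fre_lift).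
Defined.

(* F(m_i) restricted to Ker F(d_(i+1)), with values in Ker F(e_(i+1)) *)
Definition Frm_cycle (B : A) i : {additive ab_ker (Frd B i) -> ab_ker (Fre B i.+1)}.
Proof.
refine (@ker_map _ _ _ _ _ _ (Frm B i) _).
abstract (by move=> x; rewrite Frd_E).
Defined.

Lemma Frm_cycleE B i x : val (Frm_cycle B i x) = Frm B i (val x).
Proof. by []. Qed.

Lemma Frm_cycle_bound B i x : x \in cycle_bound_pred B i -> Frm_cycle B i x = 0.
Proof.
rewrite cycle_boundE => xb; apply: val_inj; rewrite Frm_cycleE raddf0.
case: i x xb => [|i] x; first by rewrite bound_pred0 => /eqP ->; rewrite raddf0.
by rewrite bound_predS => /im_predP[y <-]; rewrite Frd_E Frm_Fre.
Qed.

Definition der_to_stab (i : nat) : nattrans (right_derived i) (sub_stab i.+1).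
Proof.
refine (@NatTrans A (right_derived i) (sub_stab i.+1)
  (fun B => quot_desc (@Frm_cycle_bound B i)) _).
abstract (move=> X Y f y; have [x <-] := der_proj_surj y;
  rewrite -der_proj_nat !quot_descE; apply: val_inj;
  rewrite Frm_cycleE cycle_mapE; exact: Frm_lift).
Defined.

Definition rho : nattrans F (right_derived 0) := sat_to_der 0.

Definition beta : nattrans (right_derived 0) (sub_stab 1) := der_to_stab 0.

End FundamentalSequence.

(* Main.v *)
From HB Require Import structures.
From mathcomp Require Import all_boot all_algebra.
From mathcomp Require Import boolp.
Require Import Defs.

Set Implicit Arguments.
Unset Strict Implicit.
Unset Printing Implicit Defensive.

Import GRing.Theory.
Local Open Scope ring_scope.

(** Parts (1)-(4) are diagram chases based on [F(d_(i+1)) = F(e_(i+1)) F(m_i)];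
    exactness at [R_iF] is that of [F(Omega^i B) -> F(P_i) -> F(Omega^(i+1) B)].
    For (5), [rho_F] is an isomorphism exactly when every
    [0 -> F(B) -> F(P_0) -> F(P_1)] is exact; left-exactness on an arbitrary
    [X -> Y -> Z -> 0] then follows by lifting the projectives [P_0(Y)],
    [P_0(Z)], [P_1(Z)] along the given maps. *)

(** Since [g \oc h = 0], [h] factors through the kernel [k] of [g]; projectivity then lifts that
    factor along the epi [e]. *)
Lemma projective_lift_exact (A : preadditive) (X Y Z Q : A)
    (f : hom X Y) (g : hom Y Z) (h : hom Q Y) :
  exact_at f g -> projective Q -> g \oc h = 0 -> exists t, f \oc t = h.
Proof.
move=> [I [e [k [-> ee kg]]]] Qp gh0.
have [u <-] := kernel_fact kg gh0; have [t <-] := Qp _ _ e u ee.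
by exists t; rewrite cmpA.
Qed.

Lemma exact_at_comp0 (A : preadditive) (X Y Z : A)
    (f : hom X Y) (g : hom Y Z) : exact_at f g -> g \oc f = 0.
Proof. by move=> [I [e [k [-> _ [gk0 _]]]]]; rewrite cmpA gk0 cmp0m. Qed.

Lemma syzygy_short_exact (A : preadditive) (B : A) (P : resolution B) i :
  short_exact (rm P i) (re P i).
Proof.
split; [exact: kernel_mono (rm_kernel P i) | | exact: re_epi].
(* [rm P i] is already a kernel, so the epi in its factorisation is the identity. *)
exists (rsyz P i.+1), (idm _), (rm P i); split; last exact: rm_kernel.
- by rewrite cmpm1.
- by move=> W g h; rewrite !cmpm1.
Qed.

Section AdditiveMaps.
Variables (U V : zmodType).

Lemma additive_injective (f : {additive U -> V}) :
  (forall x, f x = 0 -> x = 0) -> injective f.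
Proof.
by move=> f0 x y fxy; apply/subr0_eq/f0; rewrite raddfB fxy subrr.
Qed.

Lemma additive_bij_inverse (f : {additive U -> V}) :
  injective f -> surj f ->
  exists g : {additive V -> U}, cancel f g /\ cancel g f.
Proof.
move=> fI fS; pose g y := sval (cid (fS y)).
have gK : cancel g f by move=> y; exact: svalP (cid (fS y)).
have gB : zmod_morphism g by move=> x y; apply: fI; rewrite raddfB !gK.
pose gM := GRing.isZmodMorphism.Build V U g gB.
pose ga : {additive V -> U} := HB.pack g gM.
by exists ga; split=> // x; apply: fI; rewrite gK.
Qed.

End AdditiveMaps.

(** Objectwise inverses are automatically natural: since [a] is injective, their naturality can be
    tested after applying [a]. *)
Lemma nt_isoP (A : preadditive) (F G : cfunctor A) (a : nattrans F G) :
  nt_iso a <-> nt_monic a /\ nt_epic a.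
Proof.
split=> [[b bK]|[aI aS]].
  split=> X; first exact: can_inj (bK X).1.
  by move=> y; exists (b X y); exact: (bK X).2.
have inv X := cid (additive_bij_inverse (aI X) (aS X)).
unshelve eexists; [exists (fun X => sval (inv X)) | ].
  move=> X Y f y; have [_ KX] := svalP (inv X); have [_ KY] := svalP (inv Y).
  by apply: aI; rewrite KX ntnat KY.
by move=> X; exact: svalP (inv X).
Qed.

Section FundamentalSequence.
Variables (A : preadditive) (P : forall B : A, resolution B) (F : cfunctor A).

Lemma der_proj_eq0 B i (x : ab_ker (Frd P F B i)) :
  der_proj P F B i x = 0 <-> val x \in @bound_pred _ P F B i.
Proof.
rewrite -cycle_boundE -(raddf0 (der_proj P F B i)) -{2}[x]subr0.
by split=> /quot_projP.
Qed.

Lemma sat_projS_eq0 B i (x : F (rsyz (P B) i.+1)) :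
  sat_proj P F B i.+1 x = 0 <-> exists y, Frm P F B i y = x.
Proof.
rewrite -(raddf0 (sat_proj P F B i.+1)) -{2}[x]subr0.
by split=> [/quot_projP/im_predP|/im_predP/quot_projP].
Qed.

Lemma der_to_stabE B i (x : ab_ker (Frd P F B i)) :
  val (der_to_stab P F i B (der_proj P F B i x)) = Frm P F B i (val x).
Proof. by rewrite [der_to_stab P F i B _]quot_descE. Qed.

(** For positive degree, a class of [x] dying in the derived functor means F(e)x = F(d)z =
    F(e)F(m)z; then x - F(m)z lies in Ker F(e) and has the same class as [x] in the satellite. In
    degree 0 nothing is divided out, so [x] itself is in the kernel. *)
Lemma stab_sat_exact i : nt_exact (stab_to_sat P F i) (sat_to_der P F i).
Proof.
move=> B y; have [x <-] := sat_proj_surj y.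
rewrite [sat_to_der P F i B _]sat_to_der_appE der_proj_eq0 Fre_cycleE.
split=> [xb|[z zE]]; last first.
  suff: der_proj P F B i (Fre_cycle P F B i x) = 0 by move/der_proj_eq0.
  rewrite -sat_to_der_appE -zE [stab_to_sat _ _ _ _ _]/= sat_to_der_appE.
  rewrite (_ : Fre_cycle _ _ _ _ _ = 0) ?raddf0 //.
  by apply: val_inj; rewrite Fre_cycleE raddf0; exact: ker_valP.
case: i x xb {y} => [|i] x xb.
  by move: xb; rewrite bound_pred0 => xb; exists (AbKer xb).
move: xb; rewrite bound_predS => /im_predP[z]; rewrite Frd_E => zE.
have xz0 : x - Frm P F B i z \in ker_pred (Fre P F B i.+1).
  by rewrite /ker_pred unfold_in raddfB zE subrr.
exists (AbKer xz0); rewrite [LHS]/=; apply/subr0_eq; rewrite -raddfB.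
(* The two representatives differ by (x - F(m)z) - x = F(m)(-z). *)
by apply/sat_projS_eq0; exists (- z); rewrite raddfN addrAC subrr sub0r.
Qed.

(** If x = F(m)y lies in Ker F(e), then F(d)y = F(e)F(m)y = 0, so [y] is a cycle and its class maps
    to [x]. *)
Lemma der_stab_exact i : nt_exact (der_to_stab P F i) (stab_to_sat P F i.+1).
Proof.
move=> B x; rewrite (_ : stab_to_sat P F i.+1 B x = sat_proj P F B i.+1 (val x)) //.
rewrite sat_projS_eq0; split=> [[y yE]|[z <-]]; last first.
  by have [y <-] := der_proj_surj z; exists (val y); rewrite der_to_stabE.
have y0 : y \in ker_pred (Frd P F B i).
  by rewrite /ker_pred unfold_in Frd_E yE; apply/eqP; exact: ker_valP.
exists (der_proj P F B i (AbKer y0)); apply: val_inj.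
by rewrite der_to_stabE.
Qed.

Lemma sat_der_stab0 i : nt_comp_zero (sat_to_der P F i) (der_to_stab P F i).
Proof.
move=> B y; have [x <-] := sat_proj_surj y; apply: val_inj.
rewrite [sat_to_der P F i B _]sat_to_der_appE der_to_stabE Fre_cycleE Frm_Fre.
by rewrite raddf0.
Qed.

Lemma stab_to_sat0_monic : nt_monic (stab_to_sat P F 0).
Proof. by move=> B x y; exact: val_inj. Qed.

(** Half-exactness applied to the syzygy sequence writes a cycle killed by F(m) as F(e)z. *)
Lemma sat_der_exact i : half_exact F ->
  nt_exact (sat_to_der P F i) (der_to_stab P F i).
Proof.
move=> hF B y; split=> [|[x <-]]; last exact: sat_der_stab0.
have [x <-] := der_proj_surj y => /(congr1 val); rewrite der_to_stabE raddf0.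
move=> /(hF _ _ _ _ _ (syzygy_short_exact (P B) i) (val x)) [z zE].
exists (sat_proj P F B i z); rewrite [LHS]sat_to_der_appE.
by congr (der_proj _ _ _ _ _); apply: val_inj; rewrite Fre_cycleE.
Qed.

(** As the kernel m_0 is monic, F(m_0) is onto, so every class in S^1F is zero and exactness at the
    preceding term gives surjectivity. *)
Lemma beta_epic : mono_to_epi F -> nt_epic (beta P F).
Proof.
move=> Fme B x.
have [y yE] := Fme _ _ _ (kernel_mono (rm_kernel (P B) 0)) (val x).
by apply/der_stab_exact/sat_projS_eq0; exists y.
Qed.

Lemma rhoE B x : rho P F B x = der_proj P F B 0 (Fre_cycle P F B 0 x).
Proof. by []. Qed.

Lemma rho_eq0 B x : rho P F B x = 0 <-> Fre P F B 0 x = 0.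
Proof. by rewrite rhoE der_proj_eq0 bound_pred0; split=> /eqP. Qed.

Lemma rho_monicP : nt_monic (rho P F) <-> forall B, injective (Fre P F B 0).
Proof.
split=> H B; apply: additive_injective => x.
  by move/rho_eq0; rewrite -(raddf0 (rho P F B)) => /H.
by move/rho_eq0; rewrite -(raddf0 (Fre P F B 0)) => /H.
Qed.

Lemma rho_epicP : nt_epic (rho P F) <->
  forall B y, Frd P F B 0 y = 0 -> exists x, Fre P F B 0 x = y.
Proof.
split=> [H B y y0|H B y].
  have y0' : y \in ker_pred (Frd P F B 0) by exact/eqP.
  have [x xE] := H B (der_proj P F B 0 (AbKer y0')); exists x.
  apply/subr0_eq; move: xE; rewrite rhoE => /eqP; rewrite -subr_eq0 -raddfB.
  by move=> /eqP/der_proj_eq0; rewrite bound_pred0 ker_valB => /eqP.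
have [z <-] := der_proj_surj y; have [x xE] := H B (val z) (ker_valP z).
by exists x; rewrite rhoE; congr (der_proj _ _ _ _ _); exact: val_inj.
Qed.

Lemma left_exact_rho_iso : left_exact F -> nt_iso (rho P F).
Proof.
move=> lF; have re0 B : right_exact (rd (P B) 0) (re (P B) 0).
  by split; [exact: rd_exact0 | exact: re_epi].
apply/nt_isoP; split.
  by apply/rho_monicP => B; exact: (lF _ _ _ _ _ (re0 B)).1.
by apply/rho_epicP => B y; exact: ((lF _ _ _ _ _ (re0 B)).2 y).1.
Qed.

Lemma rho_iso_left_exact : nt_iso (rho P F) -> left_exact F.
Proof.
move=> /nt_isoP[/rho_monicP eI /rho_epicP eS] X Y Z f g [fg ge].
have [l lE] := @rproj_projective _ _ (P Z) 0 _ _ g (re (P Z) 0) ge.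
split.
  apply: additive_injective => z gz0; apply: (eI Z).
  by rewrite /Fre -lE fmapC gz0 !raddf0.
move=> y; split=> [fy0|[z <-]]; last first.
  by rewrite -fmapC (exact_at_comp0 fg) fmap0.
have Ff0 W (t : hom W X) : fmap F (f \oc t) y = 0 by rewrite fmapC fy0 raddf0.
(* F(l)y is a cycle: g l d_1 = e_0 d_1 = 0, so l d_1 factors through [f], and F(f) kills [y]. *)
have [z zE] : exists z, Fre P F Z 0 z = fmap F l y.
  apply: eS; rewrite /Frd -fmapC.
  have [|t <-] := projective_lift_exact fg (@rproj_projective _ _ (P Z) 1)
    (h := l \oc rd (P Z) 0); last exact: Ff0.
  by rewrite cmpA lE /rd cmpA re_rm cmp0m.
(* By injectivity of F(e_0) on Y, it suffices to compare F(g)z and [y] on P_0(Y). With [s] lifting g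
   e_0 to P_0(Z), F(g)z becomes F(l s)y, and the error e_0 - l s is killed by [g], hence factors
   through [f]. *)
exists z; apply: (eI Y).
have [s sE] := @rproj_projective _ _ (P Y) 0 _ _ (re (P Z) 0)
  (g \oc re (P Y) 0) (re_epi (P Z) 0).
rewrite /Fre -fmapC -sE fmapC -/(Fre P F Z 0) zE -fmapC.
have [|t tE] := projective_lift_exact fg (@rproj_projective _ _ (P Y) 0)
  (h := re (P Y) 0 - l \oc s).
  by rewrite cmpDr cmpNr cmpA lE sE subrr.
by apply/esym/subr0_eq; rewrite -fmapB -tE Ff0.
Qed.

End FundamentalSequence.

Theorem theorem9p2
  (A : preadditive) (abA : abelian A) (enA : enough_projectives A)
  (P : forall B : A, resolution B) (F : cfunctor A) :
  [/\ [/\ forall i : nat,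
            [/\ nt_comp_zero (stab_to_sat P F i) (sat_to_der P F i),
                nt_comp_zero (sat_to_der P F i) (der_to_stab P F i)
              & nt_comp_zero (der_to_stab P F i) (stab_to_sat P F i.+1)],
          nt_monic (stab_to_sat P F 0),
          forall i : nat, nt_exact (stab_to_sat P F i) (sat_to_der P F i)
        & forall i : nat, nt_exact (der_to_stab P F i) (stab_to_sat P F i.+1)],
      half_exact F ->
        nt_monic (stab_to_sat P F 0) /\
        forall i : nat,
          [/\ nt_exact (stab_to_sat P F i) (sat_to_der P F i),
              nt_exact (sat_to_der P F i) (der_to_stab P F i)
            & nt_exact (der_to_stab P F i) (stab_to_sat P F i.+1)],
      mono_to_epi F -> nt_epic (beta P F),
      epi_to_mono F -> zero_functor (sub_stab P F 0) /\ nt_monic (rho P F)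
    & nt_iso (rho P F) <-> left_exact F].
Proof.
have stab_sat0 i : nt_comp_zero (stab_to_sat P F i) (sat_to_der P F i).
  by move=> B x; apply/stab_sat_exact; exists x.
have der_sat0 i : nt_comp_zero (der_to_stab P F i) (stab_to_sat P F i.+1).
  by move=> B x; apply/der_stab_exact; exists x.
split.
- split=> [i||i|i].
  + by split; [exact: stab_sat0 | exact: sat_der_stab0 | exact: der_sat0].
  + exact: stab_to_sat0_monic.
  + exact: stab_sat_exact.
  + exact: der_stab_exact.
- move=> hF; split=> [|i]; first exact: stab_to_sat0_monic.
  by split; [exact: stab_sat_exact | exact: sat_der_exact | exact: der_stab_exact].
- exact: beta_epic.
- move=> Fem; have eI B : injective (Fre P F B 0) by apply/Fem/re_epi.
  split; last exact/rho_monicP.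
  by move=> B x; apply: val_inj; apply: eI; rewrite ker_valP !raddf0.
- by split; [exact: rho_iso_left_exact | exact: left_exact_rho_iso].
Qed.
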